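(* Let $J\ge1$ be an integer, let $J\le M_1<\cdots<M_r\le2J$ be integers, and let $\lambda_1,\ldots,\lambda_r\ge0$, where $r\ge1$ is arbitrary. Set $$x_n=n^{-3/2}\sum_{j=1}^r\lambda_j\mathbf 1_{\{1\le n\le M_j\}}\qquad(n\ge1).$$ Then $\mathcal C(x)<2AE_3$ unless every $\lambda_j$ is zero. The estimate holds for all $J$, all such cutoffs and any number of layers, and it is invariant under a common frequency dilation, i.e. it holds also for the sequence $x'$ with $x'_{qn}=x_n$ ($n\ge1$) and $x'_k=0$ for $q\nmid k$, for any integer $q\ge1$.
   Context: For a nonnegative sequence $x=(x_n)_{n\ge1}$, $$A=\sum_{n\ge1}x_n,\qquad E_3=\sum_{n\ge1}n^3x_n^2,\qquad \mathcal C(x)=\sum_{a,b\ge1}(a+b)(a^2+ab+b^2)x_ax_bx_{a+b}.$$ *)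

(* Defs.v *)
From HB Require Import structures.
From mathcomp Require Import all_boot all_order all_algebra.
From mathcomp Require Import all_classical all_reals all_analysis.

Set Implicit Arguments.
Unset Strict Implicit.
Unset Printing Implicit Defensive.

Import Order.TTheory GRing.Theory Num.Theory.
Local Open Scope ring_scope.

(* A sequence (x_n)_{n >= 1} is a function on nat whose value at 0 is never
   used.  For nonnegative sequences the series below have nonnegative terms, so
   they are meaningful in [0, +oo] without any convergence assumption. *)

Definition mass (R : realType) (x : nat -> R) : \bar R :=
  (\sum_(1 <= n <oo) (x n)%:E)%E.

Definition energy3 (R : realType) (x : nat -> R) : \bar R :=
  (\sum_(1 <= n <oo) (n%:R ^+ 3 * x n ^+ 2)%:E)%E.

Definition cubic_form (R : realType) (x : nat -> R) : \bar R :=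
  (\sum_(1 <= a <oo) \sum_(1 <= b <oo)
     ((a%:R + b%:R) * (a%:R ^+ 2 + a%:R * b%:R + b%:R ^+ 2)
      * x a * x b * x (a + b)%N)%:E)%E.

Definition layered_seq (R : realType) (r : nat) (M : 'I_r -> nat)
    (lambda : 'I_r -> R) (n : nat) : R :=
  n%:R `^ (- (3 / 2)) * \sum_(j < r) lambda j * (1 <= n <= M j)%N%:R.

Definition dilate (R : realType) (q : nat) (x : nat -> R) (k : nat) : R :=
  if (q %| k)%N then x (k %/ q)%N else 0.

(* Main.v *)
Require Import Defs.
From HB Require Import structures.
From mathcomp Require Import all_boot all_order all_algebra.
From mathcomp Require Import all_classical all_reals all_analysis.
From mathcomp Require Import zify ring lra.
Set Implicit Arguments.
Unset Strict Implicit.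
Unset Printing Implicit Defensive.
Import Order.TTheory GRing.Theory Num.Theory.
Local Open Scope ring_scope.

(** Write [x_n = w_n / n^(3/2)]; the weight [w] equals [L], the sum of the
    lambda_j, on [1, J], lies between 0 and [L] everywhere, and vanishes beyond
    [N = 2J].  Only these three facts about [w] matter.  In terms of [w],
    [A] is the sum of [n^(-3/2) w_n], [E_3] is the sum of [w_n^2], and the
    cubic form has the kernel
      [K(a,b) = (a^2 + ab + b^2) / ((ab)^(3/2) (a+b)^(1/2))].

    The kernel is [a^(-3/2) + b^(-3/2)] plus a nonnegative excess [D(a,b)], with
    a closed form found by rationalising in the square roots ([kernelE]).
    By symmetry the first two terms contribute twice the sum over [b] of
      [b^(-3/2) w_b * (sum over a of w_a w_(a+b))].
    If the inner sum were replaced by [E_3] this would be exactly [2 A E_3], so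
    the theorem is a comparison between the loss in that autocorrelation and
    the cost of the excess.

    Loss: for [1 <= b <= N] the autocorrelation of [w] at lag [b] is at most
    [E_3 - b L^2 / 2] ([autocorrelation_le]), which gains in total
    [L^2 * sum over b of w_b / sqrt b].

    Cost: the excess summed along [a + b = n] is at most [1 / sqrt n]
    ([excess_sum_le]), and [w_a w_b <= L^2], so it costs at most
    [L^2 * sum over n >= 2 of w_n / sqrt n], the sum starting at 2 because a
    sum of two positive integers is at least 2.

    The loss exceeds the cost by the term [n = 1], that is by [L^3 > 0]
    ([fin_cubic_lt]).  All sequences have finite support, so the series are
    finite sums, and a dilation by [q] multiplies both sides by [q^3]. *)

(** * The kernel in terms of square roots *)

Section Kernel.
Variable R : realFieldType.
Implicit Types p q s : R.

(** Here [p], [q], [s] stand for the square roots of [a], [b], [a + b].  With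
    [m = p q] and the normalisation [s = 1], the excess has numerator
    [1 - m^2 - (p^3 + q^3) = (1 - m) (1 + m - (p + q))], and the last factor is
    [m^2 / ((1 + p) (1 + q))] because [(1 + m)^2 - (p + q)^2 = m^2].  In this
    form positivity is visible and the small denominator is only [p q]. *)
Lemma kernel_excessE p q s : 0 < p -> 0 < q -> 0 < s -> p ^+ 2 + q ^+ 2 = s ^+ 2 ->
  s ^+ 2 * ((p ^+ 2) ^+ 2 + p ^+ 2 * q ^+ 2 + (q ^+ 2) ^+ 2)
    * (p ^+ 3)^-1 * (q ^+ 3)^-1 * (s ^+ 3)^-1
  = (p ^+ 3)^-1 + (q ^+ 3)^-1
    + (s ^+ 2 - p * q) / (p * q * s * (s + p) * (s + q)).
Proof.
move=> p0 q0 s0 pqs.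
have ps : s + p != 0 by rewrite gt_eqF ?addr_gt0.
have qs : s + q != 0 by rewrite gt_eqF ?addr_gt0.
have key : ((s + p) * (s + q)) * (s ^+ 2 + p * q - s * (p + q)) = (p * q) ^+ 2.
  have -> : (s + p) * (s + q) = s ^+ 2 + p * q + s * (p + q) by ring.
  have -> : (s ^+ 2 + p * q + s * (p + q)) * (s ^+ 2 + p * q - s * (p + q)) = 
    s ^+ 4 + (p * q) ^+ 2 - s ^+ 2 * (p ^+ 2 + q ^+ 2) by ring.
  by rewrite pqs; ring.
have sum3 : p ^+ 3 + q ^+ 3 = (p + q) * (s ^+ 2 - p * q).
  by rewrite -pqs; ring.
have sum4 : (p ^+ 2) ^+ 2 + p ^+ 2 * q ^+ 2 + (q ^+ 2) ^+ 2
   = (s ^+ 2 + p * q) * (s ^+ 2 - p * q).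
  by rewrite -pqs; ring.
have -> : (s ^+ 2 - p * q) / (p * q * s * (s + p) * (s + q))
   = (s ^+ 2 - p * q) * (s ^+ 2 + p * q - s * (p + q)) / ((p * q) ^+ 3 * s).
  have -> : (s ^+ 2 - p * q) * (s ^+ 2 + p * q - s * (p + q)) / ((p * q) ^+ 3 * s)
   = (s ^+ 2 - p * q) * (((s + p) * (s + q)) * (s ^+ 2 + p * q - s * (p + q)))
       / ((p * q) ^+ 3 * s * ((s + p) * (s + q))).
    by field; rewrite ?qs ?ps ?gt_eqF.
  by rewrite key; field; rewrite ?qs ?ps ?gt_eqF.
rewrite sum4.
have -> : (p ^+ 3)^-1 + (q ^+ 3)^-1 = (p ^+ 3 + q ^+ 3) / (p * q) ^+ 3.
  by field; rewrite ?gt_eqF.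
by rewrite sum3; field; rewrite ?gt_eqF.
Qed.

(** As [p] tends to 0 the excess behaves like [1 / (2 p) - 1], which fixes the
    first coefficient.  The coefficients -2/3 and 1/2 are chosen so that the
    bound still holds at [p = q], while the antiderivative [Psi] below stays
    under 1/2 there; the exact integral of the excess over this half-range is
    [(4 - pi) / 2], about 0.43, which leaves room for round coefficients. *)
Lemma unit_excess_le p q : 0 < p -> p <= q -> p ^+ 2 + q ^+ 2 = 1 ->
  (1 - p * q) / (p * q * (1 + p) * (1 + q)) <= 1 / (2 * p) - 2 / 3 + p / 2.
Proof.
move=> p0 pq pq1.
have q0 : 0 < q by lra.
have x12 : p ^+ 2 <= 1 / 2 by nra.
have p34 : p <= 3 / 4 by nra.
(* After substituting [q^2 = 1 - p^2] the goal is linear in [q] with a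
   nonnegative coefficient, so a polynomial lower bound for
   [q = sqrt (1 - p^2)] reduces it to a polynomial inequality in [p]. *)
have qge : 1 - p ^+ 2 / 2 - p ^+ 4 / 4 <= q.
  have x0 : 0 <= p ^+ 2 by exact: sqr_ge0.
  rewrite -(@ler_pXn2r _ 2) ?nnegrE ?(ltW q0) //; last first.
    by rewrite (_ : p ^+ 4 = p ^+ 2 * p ^+ 2); [nra|ring].
  have -> : q ^+ 2 = 1 - p ^+ 2 by rewrite -pq1; ring.
  have -> : p ^+ 4 = (p ^+ 2) ^+ 2 by ring.
  move: (p ^+ 2) x0 x12 => x x0 x12.
  have : 0 <= x ^+ 2 * (1 / 4 - x / 4 - x ^+ 2 / 16).
    by apply: mulr_ge0; [exact: sqr_ge0|nra].
  lra.
have -> : 1 / (2 * p) - 2 / 3 + p / 2 = (3 - 4 * p + 3 * p ^+ 2) / (6 * p).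
  by field; rewrite gt_eqF.
rewrite ler_pdivrMr; last by rewrite !mulr_gt0 ?addr_gt0.
have -> : (3 - 4 * p + 3 * p ^+ 2) / (6 * p) * (p * q * (1 + p) * (1 + q)) =
  (3 - 4 * p + 3 * p ^+ 2) * (1 + p) * (q + q ^+ 2) / 6 by field; rewrite gt_eqF.
have -> : q ^+ 2 = 1 - p ^+ 2 by rewrite -pq1; ring.
have D0 : 0 <= 3 + 5 * p - p ^+ 2 + 3 * p ^+ 3.
  have : 0 <= p ^+ 3 by rewrite exprn_ge0 // ltW.
  lra.
have := ler_wpM2r D0 qge.
have p3 : 0 <= p * (4 - 13 / 2 * p + 9 / 2 * p ^+ 2 + 3 / 4 * p ^+ 3 - 23 / 4 * p ^+ 4 + 1 / 4 * p ^+ 5 - 3 / 4 * p ^+ 6).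
  apply: mulr_ge0; first exact: ltW.
  have h4 : p ^+ 4 <= p ^+ 2 / 2 by rewrite (_ : p ^+ 4 = p ^+ 2 * p ^+ 2); [nra|ring].
  have h6 : p ^+ 6 <= p ^+ 2 / 4 by rewrite (_ : p ^+ 6 = p ^+ 2 * p ^+ 4); [nra|ring].
  have h3 : 0 <= p ^+ 3 by rewrite exprn_ge0 // ltW.
  have h5 : 0 <= p ^+ 5 by rewrite exprn_ge0 // ltW.
  nra.
lra.
Qed.

(** In the variable [t^2], where [t^2 = a / n], the derivative of [Psi] is the
    bound of [unit_excess_le]. *)
Definition Psi (t : R) := t - 2 / 3 * t ^+ 2 + t ^+ 3 / 3.

(** The comparison of a sum with an integral: [Psi] is concave as a function of
    [t^2] on the relevant range, so its derivative at the right end of a step,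
    which dominates the excess, is at most its increment over the step. *)
Lemma excess_le_increment p q p' s : 0 <= p' -> p' < p -> p <= q -> 0 < s ->
  p ^+ 2 + q ^+ 2 = s ^+ 2 -> p ^+ 2 = p' ^+ 2 + 1 ->
  (s ^+ 2 - p * q) / (p * q * s * (s + p) * (s + q))
    <= (Psi (p / s) - Psi (p' / s)) / s.
Proof.
move=> p'0 p'p pq s0 pqs pp'.
have sn : s != 0 by rewrite gt_eqF.
have p0 : 0 < p by lra.
have q0 : 0 < q by lra.
have ps : s + p != 0 by rewrite gt_eqF ?addr_gt0.
have qs : s + q != 0 by rewrite gt_eqF ?addr_gt0.
(* The factor [1] between [p^2] and [p'^2] becomes [x^2 - z^2 = 1 / s^2] after
   dividing by [s]. *)
have [x xE] : {x | x = p / s} by exists (p / s).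
have [y yE] : {y | y = q / s} by exists (q / s).
have [z zE] : {z | z = p' / s} by exists (p' / s).
have pE : p = x * s by rewrite xE divfK.
have qE : q = y * s by rewrite yE divfK.
have p'E : p' = z * s by rewrite zE divfK.
have x0 : 0 < x by rewrite xE divr_gt0.
have y0 : 0 < y by rewrite yE divr_gt0.
have z0 : 0 <= z by rewrite zE divr_ge0 // ltW.
have zx : z < x by rewrite xE zE ltr_pM2r // invr_gt0.
have xy : x <= y by rewrite xE yE ler_pM2r // invr_gt0.
have xy1 : x ^+ 2 + y ^+ 2 = 1.
  have s2 : s ^+ 2 != 0 by rewrite expf_neq0.
  by apply: (mulIf s2); rewrite mul1r -[RHS]pqs pE qE; ring.
have xz : x ^+ 2 - z ^+ 2 = (s ^+ 2)^-1.
  have s2 : s ^+ 2 != 0 by rewrite expf_neq0.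
  apply: (mulIf s2); rewrite mulVf //.
  have := pp'; rewrite pE p'E => h; lra.
have -> : (s ^+ 2 - p * q) / (p * q * s * (s + p) * (s + q)) =
   (1 - x * y) / (x * y * (1 + x) * (1 + y)) * (x ^+ 2 - z ^+ 2) / s.
  rewrite xz pE qE; field; rewrite sn !gt_eqF ?addr_gt0 //; nra.
rewrite -xE -zE ler_pM2r ?invr_gt0 //.
have le := unit_excess_le x0 xy xy1.
have d0 : 0 <= x ^+ 2 - z ^+ 2 by rewrite xz invr_ge0 exprn_ge0 // ltW.
apply: (le_trans (ler_wpM2r d0 le)).
have -> : Psi x - Psi z = (x - z) * (1 - 2 / 3 * (x + z) + (x ^+ 2 + x * z + z ^+ 2) / 3).
  by rewrite /Psi; field.
have -> : (1 / (2 * x) - 2 / 3 + x / 2) * (x ^+ 2 - z ^+ 2) =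
  (x - z) * ((1 / (2 * x) - 2 / 3 + x / 2) * (x + z)) by ring.
apply: ler_wpM2l; first by lra.
have -> : (1 / (2 * x) - 2 / 3 + x / 2) * (x + z) =
   (1 / 2 + z / (2 * x)) - 2 / 3 * (x + z) + x * (x + z) / 2.
  by field; rewrite gt_eqF.
have zxE : z / (2 * x) = 1 / 2 - (x - z) / (2 * x) by field; rewrite gt_eqF.
have xx : x ^+ 2 <= 1 / 2 by nra.
have : (x - z) * (x + 2 * z) / 6 <= (x - z) / (2 * x).
  rewrite ler_pdivlMr ?mulr_gt0 //.
  have : x * (x + 2 * z) <= 3 / 2 by nra.
  have : 0 <= x - z by lra.
  nra.
rewrite zxE; lra.
Qed.

Lemma Psi_le_half (t : R) : 0 <= t -> t ^+ 2 <= 1 / 2 ->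
  Psi t <= 1 / 2.
Proof.
rewrite /Psi =>  t0 t2.
have t34 : t <= 3 / 4 by nra.
have : t ^+ 3 <= t / 2 by rewrite exprSr; nra.
nra.
Qed.
End Kernel.

(** * The excess of the kernel summed along a + b = n *)

Section Excess.
Variable R : rcfType.
Local Notation sq n := (Num.sqrt (n%:R : R)).

Definition pow32V (n : nat) : R := (sq n ^+ 3)^-1.

Definition coef (a b : nat) : R :=
  (a%:R + b%:R) * (a%:R ^+ 2 + a%:R * b%:R + b%:R ^+ 2).

Definition excess (a b : nat) : R :=
  (sq (a + b)%N ^+ 2 - sq a * sq b)
    / (sq a * sq b * sq (a + b)%N * (sq (a + b)%N + sq a) * (sq (a + b)%N + sq b)).

Lemma sqrt_nat_gt0 n : (0 < n)%N -> 0 < sq n.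
Proof. by move=> n0; rewrite sqrtr_gt0 ltr0n. Qed.

Lemma sqr_sqrt_nat n : sq n ^+ 2 = n%:R.
Proof. by rewrite sqr_sqrtr ?ler0n. Qed.

Lemma excessC a b : excess a b = excess b a.
Proof.
rewrite /excess addnC (mulrC (sq a)); congr (_ / _).
by rewrite -!mulrA (mulrC (_ + sq a)).
Qed.

Lemma kernelE a b : (0 < a)%N -> (0 < b)%N ->
  coef a b * pow32V a * pow32V b * pow32V (a + b)
  = pow32V a + pow32V b + excess a b.
Proof.
move=> a0 b0; rewrite /pow32V /excess -kernel_excessE ?sqrt_nat_gt0 ?addn_gt0 ?a0 //.
  by rewrite !sqr_sqrt_nat /coef natrD.
by rewrite !sqr_sqrt_nat natrD.
Qed.

Lemma excess_ge0 a b : 0 <= excess a b.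
Proof.
apply: divr_ge0; last by rewrite !mulr_ge0 ?addr_ge0 ?sqrtr_ge0.
have -> : sq (a + b)%N ^+ 2 = sq a ^+ 2 + sq b ^+ 2.
  by rewrite !sqr_sqrt_nat natrD.
have : 0 <= sq a * sq b by rewrite mulr_ge0 ?sqrtr_ge0.
have := sqr_ge0 (sq a - sq b); lra.
Qed.

(** On the half [a <= n / 2] the smaller of the two parts is [a], so the excess
    is bounded by increments of [Psi], and the sum telescopes. *)
Lemma half_excess_sum_le n h : (0 < n)%N -> (2 * h <= n)%N ->
  \sum_(1 <= a < h.+1) excess a (n - a) <= (2 * sq n)^-1.
Proof.
move=> n0 hn.
have s0 := sqrt_nat_gt0 n0.
pose T a := Psi (sq a / sq n) / sq n.
have step a : (0 <= a < h)%N -> excess a.+1 (n - a.+1) <= T a.+1 - T a.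
  move=> /andP[_ ah]; rewrite /excess /T -mulrBl.
  have -> : (a.+1 + (n - a.+1) = n)%N by lia.
  apply: excess_le_increment => //; rewrite ?sqr_sqrt_nat ?sqrtr_ge0 //.
  - by rewrite ltr_sqrt ?ltr_nat ?ltr0n.
  - by rewrite ler_sqrt ?ler_nat ?ler0n //; lia.
  - by rewrite -natrD; congr (_%:R); lia.
  - by rewrite natr1.
rewrite big_add1 /=.
apply: (le_trans (ler_sum_nat step)); rewrite telescope_sumr //.
have -> : T 0%N = 0 by rewrite /T /Psi sqrtr0 mul0r; field; rewrite gt_eqF.
rewrite subr0 /T invfM ler_pM2r ?invr_gt0 // -[2^-1]div1r.
apply: Psi_le_half; first by rewrite divr_ge0 // sqrtr_ge0.
rewrite expr_div_n !sqr_sqrt_nat ler_pdivrMr ?ltr0n // mul1r mulrC.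
by rewrite ler_pdivlMr // mulrC -natrM ler_nat.
Qed.

(** The excess is symmetric, so the range splits into two halves to which the
    previous bound applies; when [n] is even the middle term is put in the
    first one. *)
Lemma excess_sum_le n : (0 < n)%N ->
  \sum_(1 <= a < n) excess a (n - a) <= (sq n)^-1.
Proof.
move=> n0; have s0 := sqrt_nat_gt0 n0.
rewrite (@big_cat_nat _ _ _ (n./2).+1) //=; last by lia.
have -> : (sq n)^-1 = (2 * sq n)^-1 + (2 * sq n)^-1 by field; rewrite gt_eqF.
apply: lerD; first by apply: half_excess_sum_le; lia.
have -> : \sum_((n./2).+1 <= a < n) excess a (n - a)
        = \sum_(1 <= a < (n - (n./2).+1).+1) excess a (n - a).
  rewrite [RHS]big_nat_rev -{1}[(n./2).+1]add1n big_addn.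
  rewrite (_ : (n - n./2 = (n - n./2.+1).+1)%N); last by lia.
  by apply: eq_big_nat => a ha; rewrite excessC; congr (excess _ _); lia.
apply: half_excess_sum_le; lia.
Qed.
End Excess.

(** * Autocorrelation of the weight *)

Section Form.
Variable R : rcfType.

Lemma sum_by_total (N : nat) (f : nat -> nat -> R) (w : nat -> R) :
  (forall n, (N < n)%N -> w n = 0) ->
  \sum_(1 <= a < N.+1) \sum_(1 <= b < N.+1) f a b * w (a + b)%N
  = \sum_(1 <= n < N.+1) (\sum_(1 <= a < n) f a (n - a)%N) * w n.
Proof.
move=> w0.
transitivity (\sum_(1 <= a < N.+1) \sum_(1 <= n < N.+1 | (a < n)%N)
    f a (n - a)%N * w n).
  apply: eq_big_nat => a /andP[a1 aN].
  rewrite -(big_nat_widenl _ _ _ xpredT (fun n => f a (n - a)%N * w n)) //.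
  rewrite -[a.+1]add1n big_addn (@big_cat_nat _ _ _ (N.+1 - a) 1 N.+1) //=; try lia.
  rewrite [X in _ + X]big1_seq ?addr0; last first.
    by move=> b; rewrite mem_index_iota => hb; rewrite w0 ?mulr0 //; lia.
  by apply: eq_big_nat => b _; rewrite addnK addnC.
rewrite (exchange_big_dep_nat xpredT) //=.
apply: eq_big_nat => n /andP[n1 nN]; rewrite mulr_suml.
by rewrite [RHS](big_nat_widen _ _ N.+1) //; lia.
Qed.

(** Since [2 w_a w_(a+b) = w_a^2 + w_(a+b)^2 - (w_a - w_(a+b))^2], the loss with
    respect to twice the energy is the sum of [w_a^2] over [a <= b] plus the sum of all the
    squared differences.  If [b <= J] the first part alone is [b L^2].
    If [b > J] it is at least [J L^2], and the [b - J] indices with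
    [N - b < a <= J], at which the weight drops from [L] to 0, supply the rest.
    The count is exact because [N = 2 J] gives [J - (N - b) = b - J]. *)
Lemma autocorrelation_le (J N : nat) (L : R) (w : nat -> R) (b : nat) :
  N = (2 * J)%N ->
  (forall n, (1 <= n <= J)%N -> w n = L) ->
  (forall n, (N < n)%N -> w n = 0) ->
  (1 <= b <= N)%N ->
  2 * \sum_(1 <= a < N.+1) w a * w (a + b)%N
    <= 2 * \sum_(1 <= a < N.+1) w a ^+ 2 - b%:R * L ^+ 2.
Proof.
move=> NE wL w0 /andP[b1 bN].
have -> : 2 * \sum_(1 <= a < N.+1) w a * w (a + b)%N =
  \sum_(1 <= a < N.+1) w a ^+ 2 + \sum_(1 <= a < N.+1) w (a + b)%N ^+ 2
   - \sum_(1 <= a < N.+1) (w a - w (a + b)%N) ^+ 2.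
  rewrite mulr_sumr -big_split -sumrB /=.
  by apply: eq_bigr => a _; ring.
have -> : \sum_(1 <= a < N.+1) w (a + b)%N ^+ 2
  = \sum_(1 <= a < N.+1) w a ^+ 2 - \sum_(1 <= a < b.+1) w a ^+ 2.
  rewrite [X in _ = X - _](@big_cat_nat _ _ _ b.+1 1 N.+1) //=.
  rewrite addrAC subrr add0r -[b.+1]add1n big_addn.
  rewrite (@big_cat_nat _ _ _ (N.+1 - b) 1 N.+1) //=; try lia.
  rewrite [X in _ + X]big1_seq ?addr0 // => a; rewrite mem_index_iota => ha.
  by rewrite w0 ?expr0n //; lia.
have const m n : (0 < m)%N -> (n <= J.+1)%N ->
    \sum_(m <= a < n) w a ^+ 2 = (n - m)%:R * L ^+ 2.
  move=> m0 nJ; rewrite mulr_natl -sumr_const_nat.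
  by apply: eq_big_nat => a ha; rewrite wL //; lia.
suff : b%:R * L ^+ 2 <= \sum_(1 <= a < b.+1) w a ^+ 2
     + \sum_(1 <= a < N.+1) (w a - w (a + b)%N) ^+ 2 by lra.
have [bJ'|Jb] := leqP b J.
  rewrite const // subn1 lerDl; apply: sumr_ge0 => a _; exact: sqr_ge0.
have -> : b%:R * L ^+ 2 = J%:R * L ^+ 2 + (J.+1 - (N - b).+1)%:R * L ^+ 2.
  by rewrite -mulrDl -natrD; congr (_%:R * _); lia.
apply: lerD.
  rewrite (@big_cat_nat _ _ _ J.+1) //=; last by lia.
  by rewrite const // subn1 lerDl; apply: sumr_ge0 => a _; exact: sqr_ge0.
rewrite -const // (@big_cat_nat _ _ _ (N - b).+1 1 N.+1) //=; last by lia.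
rewrite (@big_cat_nat _ _ _ J.+1 (N - b).+1 N.+1) /=; [|lia..].
rewrite addrCA ler_wpDr //.
  by apply: addr_ge0; apply: sumr_ge0 => a _; exact: sqr_ge0.
apply: ler_sum_nat => a ha.
by rewrite (w0 (a + b)%N) ?subr0 //; lia.
Qed.

End Form.

(** * The inequality for finite sums *)

Section Main.
Variable R : rcfType.

Definition fin_mass N (x : nat -> R) := \sum_(1 <= n < N) x n.
Definition fin_energy3 N (x : nat -> R) := \sum_(1 <= n < N) n%:R ^+ 3 * x n ^+ 2.
Definition fin_cubic N (x : nat -> R) :=
  \sum_(1 <= a < N) \sum_(1 <= b < N) coef R a b * x a * x b * x (a + b)%N.

Lemma fin_energy3E N (x w : nat -> R) :
  (forall n, x n = pow32V R n * w n) ->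
  fin_energy3 N x = \sum_(1 <= n < N) w n ^+ 2.
Proof.
move=> xE; apply: eq_big_nat => n /andP[n1 _].
rewrite xE /pow32V exprMn exprVn -exprM mulnC exprM sqr_sqrt_nat mulrA divff ?mul1r //.
by rewrite expf_neq0 // pnatr_eq0 -lt0n.
Qed.

(** The layers enter only through the three properties of [w] assumed here. *)
Lemma fin_cubic_lt (J N : nat) (L : R) (x w : nat -> R) :
  (0 < J)%N -> N = (2 * J)%N -> 0 < L ->
  (forall n, 0 <= w n <= L) ->
  (forall n, (1 <= n <= J)%N -> w n = L) ->
  (forall n, (N < n)%N -> w n = 0) ->
  (forall n, x n = pow32V R n * w n) ->
  fin_cubic N.+1 x < 2 * fin_mass N.+1 x * fin_energy3 N.+1 x.
Proof.
move=> J0 NE L0 wb wL w0 xE.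
have w_ge0 n : 0 <= w n by have /andP[] := wb n.
have w_leL n : w n <= L by have /andP[] := wb n.
have u_ge0 n : 0 <= pow32V R n by rewrite invr_ge0 exprn_ge0 // sqrtr_ge0.
rewrite (fin_energy3E _ xE); set E := \sum_(1 <= n < N.+1) w n ^+ 2.
pose A b := \sum_(1 <= a < N.+1) w a * w (a + b)%N.
pose D a b := excess R a b.
have term a b : (0 < a)%N -> (0 < b)%N ->
   coef R a b * x a * x b * x (a + b)%N
   <= pow32V R a * w a * (w b * w (b + a)%N) + pow32V R b * w b * (w a * w (a + b)%N)
      + L ^+ 2 * (D a b * w (a + b)%N).
  move=> a0 b0.
  have -> : coef R a b * x a * x b * x (a + b)%N =
    (pow32V R a + pow32V R b + D a b) * (w a * w b * w (a + b)%N).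
    by rewrite -kernelE // !xE; ring.
  have wab : w a * w b <= L ^+ 2 by rewrite expr2 ler_pM.
  have := ler_wpM2l (mulr_ge0 (excess_ge0 R a b) (w_ge0 (a + b)%N)) wab.
  rewrite [(b + a)%N]addnC /D; lra.
have cub : fin_cubic N.+1 x <= \sum_(1 <= b < N.+1) pow32V R b * w b * (2 * A b)
    + L ^+ 2 * \sum_(1 <= n < N.+1) (\sum_(1 <= a < n) D a (n - a)%N) * w n.
  rewrite -(sum_by_total _ w0) mulr_sumr.
  have -> : \sum_(1 <= b < N.+1) pow32V R b * w b * (2 * A b) =
      \sum_(1 <= a < N.+1) \sum_(1 <= b < N.+1) pow32V R a * w a * (w b * w (b + a)%N)
    + \sum_(1 <= a < N.+1) \sum_(1 <= b < N.+1) pow32V R b * w b * (w a * w (a + b)%N).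
    rewrite [X in _ + X]exchange_big_nat -big_split /=.
    apply: eq_bigr => b _; rewrite -!mulr_sumr -mulrDr.
    by congr (_ * _); rewrite mulrDl mul1r.
  rewrite -!big_split /=; apply: ler_sum_nat => a /andP[a1 _].
  rewrite mulr_sumr -!big_split /=; apply: ler_sum_nat => b /andP[b1 _].
  exact: term.
(* Gain from the autocorrelation: here [b^(-3/2) * b = 1 / sqrt b]. *)
have main : \sum_(1 <= b < N.+1) pow32V R b * w b * (2 * A b) <=
  2 * fin_mass N.+1 x * E - L ^+ 2 * \sum_(1 <= b < N.+1) w b / Num.sqrt b%:R.
  rewrite /fin_mass mulrAC [2 * E * _]mulr_sumr [L ^+ 2 * _]mulr_sumr -sumrB.
  apply: ler_sum_nat => b /andP[b1 bN].
  have sb := @sqrt_nat_gt0 R _ b1.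
  have : 2 * A b <= 2 * E - b%:R * L ^+ 2.
    by apply: (autocorrelation_le NE) => //; rewrite b1 -ltnS.
  move/(ler_wpM2l (mulr_ge0 (u_ge0 b) (w_ge0 b))) => /le_trans; apply.
  rewrite le_eqVlt; apply/orP; left; apply/eqP.
  rewrite xE /pow32V -[X in _ - X * L ^+ 2](@sqr_sqrt_nat R).
  by field; rewrite gt_eqF.
have N1 : (1 < N.+1)%N by lia.
(* The row [n = 1] is empty on the left, while on the right it is [w_1 = L];
   this difference is what makes the final inequality strict. *)
have exc : \sum_(1 <= n < N.+1) (\sum_(1 <= a < n) D a (n - a)%N) * w n
   <= \sum_(1 <= b < N.+1) w b / Num.sqrt b%:R - L.
  rewrite big_ltn // [X in _ <= X - _]big_ltn // [X in X * w 1%N]big_geq // mul0r add0r.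
  rewrite sqrtr1 divr1 (wL 1%N) // addrAC subrr add0r.
  apply: ler_sum_nat => n /andP[n1 _].
  by rewrite mulrC ler_wpM2l // excess_sum_le // ltnW.
have L2 : 0 <= L ^+ 2 by rewrite exprn_ge0 // ltW.
have := ler_wpM2l L2 exc.
have : 0 < L ^+ 2 * L by rewrite !mulr_gt0.
lra.
Qed.
End Main.

(** * Series with finite support and dilations *)

Section Series.
Variable R : realType.
Implicit Types (x f : nat -> R) (m N q : nat).

Lemma eseries_finite_support f m N : (m <= N)%N ->
  (forall n, (N <= n)%N -> f n = 0) ->
  (\sum_(m <= n <oo) (f n)%:E)%E = (\sum_(m <= n < N) f n)%:E.
Proof.
move=> mN f0; apply: lim_near_cst => //.
exists N => // K /= NK.
rewrite (@big_cat_nat _ _ _ N) //= sumEFin [X in (_ + X)%E]big1_seq ?adde0 // => i.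
by rewrite mem_index_iota => /andP[_ /andP[Ni _]]; rewrite f0.
Qed.

Lemma mass_fin x N : (0 < N)%N -> (forall n, (N <= n)%N -> x n = 0) ->
  mass x = (fin_mass N x)%:E.
Proof. by move=> N0 x0; apply: eseries_finite_support. Qed.

Lemma energy3_fin x N : (0 < N)%N -> (forall n, (N <= n)%N -> x n = 0) ->
  energy3 x = (fin_energy3 N x)%:E.
Proof.
move=> N0 x0; apply: eseries_finite_support => // n Nn.
by rewrite x0 // expr0n mulr0.
Qed.

Lemma cubic_form_fin x N : (0 < N)%N -> (forall n, (N <= n)%N -> x n = 0) ->
  cubic_form x = (fin_cubic N x)%:E.
Proof.
move=> N0 x0; rewrite /cubic_form.
under eq_eseriesr => a _.
  rewrite (@eseries_finite_support _ 1 N) //; last first.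
    by move=> b Nb; rewrite (x0 b) // mulr0 mul0r.
  over.
apply: eseries_finite_support => // a Na; apply: big1 => b _.
by rewrite (x0 a) // mulr0 !mul0r.
Qed.

Lemma sum_multiples f q N : (0 < q)%N ->
  (forall k, ~~ (q %| k)%N -> f k = 0) ->
  \sum_(1 <= k < q * N) f k = \sum_(1 <= n < N) f (q * n)%N.
Proof.
move=> q0 f0.
(* Summing from 0 makes the blocks of length [q] start at the multiples. *)
have all_sum : \sum_(0 <= k < q * N) f k = \sum_(0 <= n < N) f (q * n)%N.
  elim: N => [|N IH]; first by rewrite muln0 !big_geq.
  rewrite big_nat_recr //= -IH (@big_cat_nat _ _ _ (q * N)%N) //=; last by lia.
  congr (_ + _); rewrite big_ltn; last by lia.
  rewrite big1_seq ?addr0 // => k; rewrite mem_index_iota => hk.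
  apply: f0; apply/negP => /dvdnP[c kE].
  move: hk; rewrite kE [(c * q)%N]mulnC => /andP[_ /andP[]].
  rewrite ltn_mul2l => /andP[_ h1]; rewrite ltn_mul2l => /andP[_ h2].
  lia.
case: N all_sum => [|N]; first by rewrite muln0 !big_geq.
by rewrite big_ltn ?muln_gt0 ?q0 // [RHS]big_ltn // muln0 => /addrI.
Qed.

Lemma dilate_mul q x n : (0 < q)%N -> dilate q x (q * n)%N = x n.
Proof. by move=> q0; rewrite /dilate dvdn_mulr // mulKn. Qed.

Lemma dilate_ndvd q x k : ~~ (q %| k)%N -> dilate q x k = 0.
Proof. by move=> qk; rewrite /dilate (negbTE qk). Qed.

Lemma fin_mass_dilate q N x : (0 < q)%N ->
  fin_mass (q * N) (dilate q x) = fin_mass N x.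
Proof.
move=> q0; rewrite /fin_mass sum_multiples //; last exact: dilate_ndvd.
by apply: eq_bigr => n _; rewrite dilate_mul.
Qed.

Lemma fin_energy3_dilate q N x : (0 < q)%N ->
  fin_energy3 (q * N) (dilate q x) = q%:R ^+ 3 * fin_energy3 N x.
Proof.
move=> q0; rewrite /fin_energy3 sum_multiples //; last first.
  by move=> k qk; rewrite dilate_ndvd // expr0n mulr0.
rewrite mulr_sumr; apply: eq_bigr => n _.
by rewrite dilate_mul // natrM exprMn mulrA.
Qed.

Lemma fin_cubic_dilate q N x : (0 < q)%N ->
  fin_cubic (q * N) (dilate q x) = q%:R ^+ 3 * fin_cubic N x.
Proof.
move=> q0; rewrite /fin_cubic sum_multiples //; last first.
  by move=> a qa; rewrite big1 // => b _; rewrite (dilate_ndvd _ qa) mulr0 !mul0r.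
rewrite mulr_sumr; apply: eq_bigr => a _.
rewrite sum_multiples //; last first.
  by move=> b qb; rewrite (dilate_ndvd _ qb) mulr0 !mul0r.
rewrite mulr_sumr; apply: eq_bigr => b _.
by rewrite -mulnDr !dilate_mul // /coef !natrM; ring.
Qed.

Lemma pow32VE n : (0 < n)%N -> n%:R `^ (- (3 / 2)) = pow32V R n.
Proof.
move=> n0; rewrite /pow32V powRN mulrC powRrM.
by rewrite powR12_sqrt ?ler0n // powR_mulrn ?sqrtr_ge0.
Qed.
End Series.

Theorem theorem3p26 (R : realType) (J r : nat) (M : 'I_r -> nat)
    (lambda : 'I_r -> R)
    (hJ : (1 <= J)%N) (hr : (1 <= r)%N)
    (hM_incr : forall i j : 'I_r, (i < j)%N -> (M i < M j)%N)
    (hM_range : forall j : 'I_r, (J <= M j <= 2 * J)%N)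
    (hlambda : forall j : 'I_r, 0 <= lambda j)
    (hnonzero : ~ (forall j : 'I_r, lambda j = 0)) :
  let x := layered_seq M lambda in
  (cubic_form x < 2%:E * mass x * energy3 x)%E /\
  (forall q : nat, (1 <= q)%N ->
     (cubic_form (dilate q x)
        < 2%:E * mass (dilate q x) * energy3 (dilate q x))%E).
Proof.
move=> x.
pose w n := \sum_(j < r) lambda j * (1 <= n <= M j)%N%:R.
pose L := \sum_(j < r) lambda j.
have L0 : 0 < L.
  rewrite lt_neqAle sumr_ge0 ?andbT; last by move=> j _; exact: hlambda.
  apply/eqP => /esym L0; apply: hnonzero => j.
  by have /psumr_eq0P := L0; apply => // i _; exact: hlambda.
have wb n : 0 <= w n <= L.
  apply/andP; split; first by apply: sumr_ge0 => j _; rewrite mulr_ge0.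
  apply: ler_sum => j _; rewrite ler_piMr ?hlambda //.
  by case: (1 <= n <= M j)%N.
have wL n : (1 <= n <= J)%N -> w n = L.
  move=> /andP[n1 nJ]; apply: eq_bigr => j _.
  have /andP[JM _] := hM_range j.
  by rewrite n1 (leq_trans nJ JM) mulr1.
have w0 n : (2 * J < n)%N -> w n = 0.
  move=> Jn; apply: big1 => j _.
  have /andP[_ MJ] := hM_range j.
  by rewrite [(n <= _)%N]leqNgt (leq_ltn_trans MJ Jn) andbF mulr0.
have xE n : x n = pow32V R n * w n.
  case: n => [|n]; last by rewrite -pow32VE.
  by rewrite /x /layered_seq -/(w 0%N) [w _]big1 ?mulr0 // => j _; rewrite mulr0.
have main := fin_cubic_lt hJ erefl L0 wb wL w0 xE.
set N := (2 * J).+1 in main.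
have x0 n : (N <= n)%N -> x n = 0 by move=> Nn; rewrite xE w0 ?mulr0.
split.
  rewrite (mass_fin (N := N)) // (energy3_fin (N := N)) // (cubic_form_fin (N := N)) //.
move=> q q1.
have qN : (0 < q * N)%N by rewrite muln_gt0 q1.
have y0 n : (q * N <= n)%N -> dilate q x n = 0.
  by move=> h; rewrite /dilate; case: ifP => // _; apply: x0; rewrite leq_divRL // mulnC.
rewrite (mass_fin qN y0) (energy3_fin qN y0) (cubic_form_fin qN y0).
rewrite fin_mass_dilate // fin_energy3_dilate // fin_cubic_dilate //.
rewrite -!EFinM lte_fin mulrCA ltr_pM2l // exprn_gt0 // ltr0n //.
Qed.
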